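(* Let $\ell\in\mathbb{N}$ and let $c_{\ell}$ be a positive number less than $6e^{2\gamma}\pi^{-2}\cdot\ell^{2\ell}\cdot(2\ell+1)^{-(2\ell+1)}$. For sufficiently large $N$, we have $$\max_{|\mathcal{M}|=N}\ \sum_{m,n\in\mathcal{M}}\frac{(m,n)}{[m,n]}\log^{\ell}\Big(\frac{m}{(m,n)}\Big)\log^{\ell}\Big(\frac{n}{(m,n)}\Big)\geqslant c_{\ell}\cdot N\cdot(\log_2 N)^{2+2\ell},$$ where the maximum is taken over all subsets $\mathcal{M}\subset\mathbb{N}$ of size $N$.
   Context: $\mathbb{N}$ is the set of positive integers; $(m,n)$ denotes the greatest common divisor and $[m,n]$ the least common multiple of $m$ and $n$. $\gamma$ is the Euler constant. $\log^{\ell}(x)$ means $(\log x)^{\ell}$, and $\log_2 N := \log\log N$. *)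

(* Defs.v *)
From HB Require Import structures.
From mathcomp Require Import all_boot all_order all_algebra.
From mathcomp Require Import finmap.
From mathcomp Require Import all_classical all_reals all_analysis.
Import Order.TTheory GRing.Theory Num.Theory.
Import numFieldNormedType.Exports.

Set Implicit Arguments.
Unset Strict Implicit.
Unset Printing Implicit Defensive.

Local Open Scope classical_set_scope.
Local Open Scope ring_scope.
Local Open Scope fset_scope.

Definition euler_gamma (R : realType) : R :=
  limn (fun n : nat => \sum_(1 <= k < n.+1) (k%:R : R)^-1 - ln (n%:R : R)).

(* Positive integers are naturals, hence the exclusion of 0. *)
Definition pos_fsets_of_size (N : nat) : set {fset nat} :=
  [set M | (forall m, m \in M -> (0 < m)%N) /\ #|` M| = N].

(* The sum runs over all ordered pairs (m, n), the diagonal included. *)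
Definition log_gcd_sum (R : realType) (l : nat) (M : {fset nat}) : R :=
  \sum_(m <- M) \sum_(n <- M)
    (gcdn m n)%:R / (lcmn m n)%:R
      * ln (m%:R / (gcdn m n)%:R) ^+ l
      * ln (n%:R / (gcdn m n)%:R) ^+ l.

(* A maximum, not merely a supremum: it is required to be attained. *)
Definition is_max (R : realType) (A : set R) (v : R) : Prop :=
  A v /\ ubound A v.

(* Main.v *)
Require Import Defs.
From HB Require Import structures.
From mathcomp Require Import all_boot all_order all_algebra.
From mathcomp Require Import finmap.
From mathcomp Require Import all_classical all_reals all_analysis.
From mathcomp Require Import zify lra.
Import Order.TTheory GRing.Theory Num.Theory.
Import numFieldNormedType.Exports.

Set Implicit Arguments.
Unset Strict Implicit.

Local Open Scope classical_set_scope.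
Local Open Scope ring_scope.

(** The summand only sees the reduced fraction of the pair: if m = g a and
n = g b with a, b coprime, it equals f(a) f(b) where f(a) = log^l(a) / a.  So
the sum is invariant under dilation of the set, its terms are nonnegative, and
dilated copies of a set can be placed side by side without loss.

That the maximum is attained is not a matter of a finite search, since dilations and distant clusters
give infinitely many sets.  By strong induction on N, the best sum over sets
that split into two far apart clusters is at most v_k + v_(N-k) plus a small
error, v_k being the maximum for size k, and v_k + v_(N-k) is reached by an
actual set of size N ([gcd_sum_superadditive]).  If some set does strictly
better than all those, only sets without such a splitting matter
([cluster_dichotomy]); all ratios of elements of such a set have bounded
height, so up to dilations it is a subset of a fixed interval
([bounded_model]), and a finite family remains ([exists_max_gcd_sum]).

For the lower bound, the constant of the statement leaves room for a crude construction.  Fix y and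
let the box of side E be the set of products of p^(e_p) over the primes
p <= y with 0 <= e_p < E.  Multiplication by any a <= y maps the box of side E
into the box of side E + y, and distinct triples (m, a, b) with a, b coprime
give distinct pairs (m a, m b); hence the sum over the larger box is at least
the size of the smaller one times
  C(y) = sum over coprime a, b <= y of f(a) f(b)
([gcd_sum_ge_coprime_sum]).  With E = y^3 both boxes have nearly the same size
([card_prime_box_ratio]), at most y^(4y), so log y may be taken as
(1 - o(1)) log log N, and N is filled with copies of the box up to a negligible
proportion.

To bound C(y) below, write L = log y.  A pair that is not coprime has a common
divisor d in {2, 3, 5, 7, 9, ...}, so C(y) is at least the square of the sum S
of f over [1, y] minus the sum over these d of the squares of the sums S_d of f
over multiples of d ([coprime_sum_ge]).  Comparison with the integral of
log^l(t) / t gives S >= L^(l+1)/(l+1) - L^l and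
S_d <= (L^(l+1)/(l+1) + L^l) / d, and the sum of 1/d^2 is at most 1/2 by
telescoping.  Thus C(y) is asymptotically at least L^(2l+2) / (2 (l+1)^2).

It remains to see that the constant of the statement is at most
1 / (2 (l+1)^2) ([gamma_constant_le]).  This follows from
e^(2 gamma) <= 81/16, from pi >= 3, which together bound
6 e^(2 gamma) / pi^2 by 27/8, and from
27 l^(2l) (l+1)^2 <= 4 (2l+1)^(2l+1), an equality for l = 1. *)

(** * The summand as a function of the reduced fraction *)

Definition log_weight (R : realType) (l a : nat) : R := ln a%:R ^+ l / a%:R.

Definition gcd_term (R : realType) (l m n : nat) : R :=
  log_weight R l (m %/ gcdn m n) * log_weight R l (n %/ gcdn m n).

Lemma ln_nat_ge0 (R : realType) (n : nat) : 0 <= ln (n%:R : R).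
Proof.
case: n => [|n]; first by rewrite ln0.
by rewrite ln_ge0// ler1n.
Qed.

Lemma ln_nat_le (R : realType) (m n : nat) :
  (0 < m)%N -> (m <= n)%N -> ln (m%:R : R) <= ln n%:R.
Proof.
move=> m0 mn; rewrite ler_ln ?posrE ?ltr0n ?ler_nat//.
exact: leq_trans m0 mn.
Qed.

Lemma log_weight_ge0 (R : realType) (l a : nat) : 0 <= log_weight R l a.
Proof. by rewrite divr_ge0 ?exprn_ge0 ?ln_nat_ge0. Qed.

Lemma gcd_term_ge0 (R : realType) (l m n : nat) : 0 <= gcd_term R l m n.
Proof. by rewrite mulr_ge0 ?log_weight_ge0. Qed.

Lemma gcd_termC (R : realType) (l m n : nat) :
  gcd_term R l m n = gcd_term R l n m.
Proof. by rewrite /gcd_term mulrC gcdnC. Qed.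

Lemma gcd_term_scale (R : realType) (l k m n : nat) :
  (0 < k)%N -> gcd_term R l (k * m) (k * n) = gcd_term R l m n.
Proof. by move=> k0; rewrite /gcd_term -muln_gcdr !divnMl. Qed.

Lemma gcd_term_coprime (R : realType) (l a b : nat) :
  coprime a b -> gcd_term R l a b = log_weight R l a * log_weight R l b.
Proof. by rewrite /gcd_term => /eqP ->; rewrite !divn1. Qed.

Lemma gcd_termE (R : realType) (l m n : nat) : (0 < m)%N -> (0 < n)%N ->
  (gcdn m n)%:R / (lcmn m n)%:R
      * ln (m%:R / (gcdn m n)%:R) ^+ l
      * ln (n%:R / (gcdn m n)%:R) ^+ l = gcd_term R l m n.
Proof.
move=> m0 n0; have g0 : (0 < gcdn m n)%N by rewrite gcdn_gt0 m0.
have divE k : (gcdn m n %| k)%N ->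
    (k%:R / (gcdn m n)%:R : R) = (k %/ gcdn m n)%:R.
  move=> dk; rewrite -[in LHS](divnK dk) natrM mulfK//.
  by rewrite pnatr_eq0 -lt0n.
rewrite !divE ?dvdn_gcdl ?dvdn_gcdr// /gcd_term /log_weight.
set a := (m %/ _)%N; set b := (n %/ _)%N.
have a0 : (0 < a)%N by rewrite divn_gt0// dvdn_leq// dvdn_gcdl.
have b0 : (0 < b)%N by rewrite divn_gt0// dvdn_leq// dvdn_gcdr.
have -> : lcmn m n = (gcdn m n * (a * b))%N.
  apply/eqP; rewrite -(eqn_pmul2r g0) muln_lcm_gcd.
  rewrite -[X in (X * _)%N == _](divnK (dvdn_gcdl m n)).
  rewrite -[X in (_ * X)%N == _](divnK (dvdn_gcdr m n)) -/a -/b.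
  by apply/eqP; rewrite mulnACA [RHS]mulnAC [RHS]mulnC.
rewrite !natrM invfM invfM mulVKf ?pnatr_eq0 -?lt0n//.
by rewrite -mulrA [RHS]mulrACA mulrC.
Qed.

Lemma log_gcd_sumE (R : realType) (l : nat) (M : {fset nat}) :
  (forall m, m \in M -> (0 < m)%N) ->
  log_gcd_sum R l M = \sum_(m <- M) \sum_(n <- M) gcd_term R l m n.
Proof.
move=> M0; rewrite /log_gcd_sum big_seq [RHS]big_seq.
apply: eq_bigr => m mM; rewrite big_seq [RHS]big_seq.
by apply: eq_bigr => n nM; rewrite gcd_termE ?M0.
Qed.

(** Raising e^(t/k) >= t/k to the k-th power avoids any use of the exponential
series, and serves both for the decay of f and for comparing e^Z with Z. *)
Lemma expR_ge_pow (R : realType) (k : nat) (t : R) : (0 < k)%N -> 0 <= t ->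
  t ^+ k <= k%:R ^+ k * expR t.
Proof.
move=> k0 t0; have kp : 0 < (k%:R : R) by rewrite ltr0n.
have {2}-> : t = k%:R * (t / k%:R) by rewrite mulrC divfK ?gt_eqF.
rewrite expRM_natl -exprMn lerXn2r ?nnegrE ?mulr_ge0 ?expR_ge0 ?ler0n//.
rewrite mulrC -ler_pdivrMr//; apply: le_trans (expR_ge1Dx _).
by rewrite lerDr.
Qed.

Lemma ln_pow_le (R : realType) (k a : nat) : (0 < k)%N -> (0 < a)%N ->
  ln (a%:R : R) ^+ k <= k%:R ^+ k * a%:R.
Proof.
move=> k0 a0; apply: le_trans (expR_ge_pow k0 (ln_nat_ge0 R a)) _.
by rewrite lnK// posrE ltr0n.
Qed.

Lemma log_weight_le (R : realType) (l a : nat) : (0 < l)%N ->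
  log_weight R l a <= l%:R ^+ l.
Proof.
move=> l0; case: a => [|a]; first by rewrite /log_weight invr0 mulr0 exprn_ge0.
by rewrite ler_pdivrMr ?ltr0n// ln_pow_le.
Qed.

(** One more logarithm is still dominated by a: log^(l+1)(a) / a is bounded by
(l+1)^(l+1), so f(a) is at most a constant over log a. *)
Lemma log_weight_cvg0 (R : realType) (l : nat) (e : R) : 0 < e ->
  exists T : nat, forall a, (T < a)%N -> log_weight R l a <= e.
Proof.
move=> e0; pose C : R := l.+1%:R ^+ l.+1.
have C0 : 0 <= C by rewrite exprn_ge0.
exists (Num.truncn (expR (C / e))).+1 => a Ta.
have a0 : (0 < a)%N by apply: leq_trans Ta.
have ea : expR (C / e) < a%:R.
  by apply: lt_le_trans (truncnS_gt _) _; rewrite ler_nat ltnW.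
have la : C / e < ln a%:R by rewrite -ltr_expR lnK// posrE ltr0n.
have lap : 0 < ln (a%:R : R) by apply: le_lt_trans la; rewrite divr_ge0// ltW.
rewrite ler_pdivrMr ?ltr0n// -(ler_pM2r lap) -exprSr.
apply: le_trans (ln_pow_le R (ltn0Sn l) a0) _.
rewrite mulrAC ler_wpM2r// mulrC -ler_pdivrMr//; exact: ltW.
Qed.

(** * Sums over finite sets: dilation and superadditivity *)

Definition gcd_sum (R : realType) (l : nat) (M : {fset nat}) : R :=
  \sum_(m <- M) \sum_(n <- M) gcd_term R l m n.

Definition positive_fset (M : {fset nat}) := forall m, m \in M -> (0 < m)%N.

Definition dilate (k : nat) (M : {fset nat}) : {fset nat} :=
  [fset (k * m)%N | m in M]%fset.

Lemma ler_sum_subseq (R : realType) (T : eqType) (s t : seq T) (F : T -> R) :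
  uniq s -> uniq t -> {subset s <= t} -> (forall x, x \in t -> 0 <= F x) ->
  \sum_(x <- s) F x <= \sum_(x <- t) F x.
Proof.
move=> us ut st F0; rewrite [leRHS](bigID (mem s))/=.
have -> : \sum_(x <- s) F x = \sum_(x <- t | x \in s) F x.
  rewrite -[RHS]big_filter; apply: perm_big; apply: uniq_perm => //.
    exact: filter_uniq.
  by move=> x; rewrite mem_filter; case: (boolP (x \in s)) => // /st.
rewrite lerDl big_seq_cond; apply: sumr_ge0 => x /andP[xt _]; exact: F0.
Qed.

Lemma gcd_sum_ge0 (R : realType) (l : nat) (M : {fset nat}) :
  0 <= gcd_sum R l M.
Proof. by apply: sumr_ge0 => m _; apply: sumr_ge0 => n _; exact: gcd_term_ge0. Qed.

Lemma card_dilate (k : nat) (M : {fset nat}) :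
  (0 < k)%N -> #|` dilate k M| = #|` M|.
Proof.
by move=> k0; rewrite card_imfset//= => x y /eqP; rewrite eqn_pmul2l// => /eqP.
Qed.

Lemma dilate_gt0 (k : nat) (M : {fset nat}) :
  (0 < k)%N -> positive_fset M -> positive_fset (dilate k M).
Proof. by move=> k0 M0 _ /imfsetP[m /= /M0 m0 ->]; rewrite muln_gt0 k0. Qed.

Lemma gcd_sum_dilate (R : realType) (l k : nat) (M : {fset nat}) :
  (0 < k)%N -> gcd_sum R l (dilate k M) = gcd_sum R l M.
Proof.
move=> k0.
have inj : injective (muln k).
  by move=> x y /eqP; rewrite eqn_pmul2l// => /eqP.
rewrite /gcd_sum /dilate big_imfset/=; last by move=> x y _ _; exact: inj.
apply: eq_bigr => m _; rewrite big_imfset/=; last by move=> x y _ _; exact: inj.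
by apply: eq_bigr => n _; rewrite gcd_term_scale.
Qed.

Lemma gcd_sumU (R : realType) (l : nat) (A B : {fset nat}) :
  [disjoint A & B]%fset ->
  gcd_sum R l (A `|` B)%fset = gcd_sum R l A + gcd_sum R l B
    + 2 * \sum_(a <- A) \sum_(b <- B) gcd_term R l a b.
Proof.
move=> dAB.
have big F : \sum_(x <- (A `|` B)%fset) F x
    = \sum_(x <- A) F x + \sum_(x <- B) F x :> R.
  rewrite -big_cat; apply: perm_big; apply: uniq_perm; first exact: fset_uniq.
    rewrite cat_uniq !fset_uniq andbT/=; apply/hasPn => b bB.
    by apply/negP => bA; move/fdisjointP: dAB => /(_ b bA); rewrite bB.
  by move=> x; rewrite mem_cat inE.
rewrite /gcd_sum big; under eq_bigr do rewrite big.
under [X in _ + X = _]eq_bigr do rewrite big.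
rewrite !big_split/=.
have -> : \sum_(m <- B) \sum_(n <- A) gcd_term R l m n
    = \sum_(m <- A) \sum_(n <- B) gcd_term R l m n.
  rewrite exchange_big/=; apply: eq_bigr => i _; apply: eq_bigr => j _.
  exact: gcd_termC.
by lra.
Qed.

Lemma cardfsU_disjoint (A B : {fset nat}) :
  [disjoint A & B]%fset -> #|` A `|` B|%fset = (#|` A| + #|` B|)%N.
Proof. by rewrite -fsetI_eq0 => /eqP AB; rewrite cardfsU AB cardfs0 subn0. Qed.

(** Dilating B beyond the largest element of A makes the two sets disjoint, and
the cross terms can only help. *)
Lemma gcd_sum_superadditive (R : realType) (l : nat) (A B : {fset nat}) :
  positive_fset A -> positive_fset B ->
  exists C : {fset nat}, [/\ positive_fset C, #|` C| = (#|` A| + #|` B|)%N &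
    gcd_sum R l A + gcd_sum R l B <= gcd_sum R l C].
Proof.
move=> A0 B0; pose k := (\sum_(a <- A) a).+1.
have ltk a : a \in A -> (a < k)%N.
  by move=> aA; rewrite ltnS (big_rem a)//= leq_addr.
have dis : [disjoint A & dilate k B]%fset.
  apply/fdisjointP => a aA; apply/imfsetP => /= -[b bB ab].
  by have := ltk _ aA; rewrite ab ltnNge leq_pmulr// B0.
exists (A `|` dilate k B)%fset; split.
- by move=> m; rewrite inE => /orP[/A0//|]; apply: dilate_gt0.
- by rewrite cardfsU_disjoint// card_dilate.
- rewrite gcd_sumU// gcd_sum_dilate// lerDl mulr_ge0//.
  by apply: sumr_ge0 => m _; apply: sumr_ge0 => n _; exact: gcd_term_ge0.
Qed.

Lemma exists_positive_fset (N : nat) :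
  exists2 M : {fset nat}, positive_fset M & #|` M| = N.
Proof.
exists [fset n in iota 1 N]%fset; first by move=> m; rewrite inE mem_iota => /andP[].
by rewrite card_fseq undup_id ?iota_uniq// size_iota.
Qed.

(** Disjoint dilated copies are completed to the exact size N by an arbitrary
positive set. *)
Lemma exists_gcd_sum_copies (R : realType) (l k N : nat) (A : {fset nat}) :
  positive_fset A -> (k * #|` A| <= N)%N ->
  exists M : {fset nat}, [/\ positive_fset M, #|` M| = N &
    k%:R * gcd_sum R l A <= gcd_sum R l M].
Proof.
move=> A0.
have [M [M0 cM sM]] : exists M : {fset nat}, [/\ positive_fset M,
    #|` M| = (k * #|` A|)%N & k%:R * gcd_sum R l A <= gcd_sum R l M].
  elim: k => [|k [M [M0 cM sM]]].
    by exists fset0; split=> //; rewrite mul0r gcd_sum_ge0.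
  have [C [C0 cC sC]] := gcd_sum_superadditive R l A0 M0.
  exists C; split=> //; first by rewrite cC cM mulSn.
  by apply: le_trans sC; rewrite -natr1 mulrDl mul1r addrC lerD2l.
move=> kN; have [F F0 cF] := exists_positive_fset (N - k * #|` A|).
have [C [C0 cC sC]] := gcd_sum_superadditive R l M0 F0.
exists C; split=> //; first by rewrite cC cM cF subnKC.
by apply: le_trans sM _; apply: le_trans sC; rewrite lerDl gcd_sum_ge0.
Qed.

(** * The maximum is attained *)

(** The ratio n / m has height at most H.  It need not be given in lowest
terms, which makes composition immediate. *)
Definition ratio_height_le (H m n : nat) : Prop :=
  exists a b : nat,
    [/\ (0 < a <= H)%N, (0 < b <= H)%N & (m * b = n * a)%N].

Definition close (T m n : nat) : bool :=
  (m %/ gcdn m n <= T)%N && (n %/ gcdn m n <= T)%N.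

Lemma ratio_height_refl (m : nat) : ratio_height_le 1 m m.
Proof. by exists 1%N, 1%N. Qed.

Lemma ratio_height_trans (H K m n p : nat) :
  ratio_height_le H m n -> ratio_height_le K n p ->
  ratio_height_le (H * K) m p.
Proof.
move=> [a [b [/andP[a0 aH] /andP[b0 bH] e1]]].
move=> [c [d [/andP[c0 cK] /andP[d0 dK] e2]]].
exists (a * c)%N, (b * d)%N; rewrite !muln_gt0 a0 b0 c0 d0 !leq_mul//.
by split=> //; rewrite mulnA e1 mulnAC e2 -mulnA (mulnC c).
Qed.

Lemma ratio_height_leq (H K m n : nat) :
  (H <= K)%N -> ratio_height_le H m n -> ratio_height_le K m n.
Proof.
move=> HK [a [b [/andP[a0 aH] /andP[b0 bH] e]]]; exists a, b; split=> //.
  by rewrite a0 (leq_trans aH).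
by rewrite b0 (leq_trans bH).
Qed.

Lemma close_ratio_height (T m n : nat) :
  (0 < m)%N -> (0 < n)%N -> close T m n -> ratio_height_le T m n.
Proof.
move=> m0 n0 /andP[mT nT]; exists (m %/ gcdn m n)%N, (n %/ gcdn m n)%N.
have g0 : (0 < gcdn m n)%N by rewrite gcdn_gt0 m0.
have gm := dvdn_gcdl m n; have gn := dvdn_gcdr m n.
rewrite mT nT !andbT !divn_gt0// (dvdn_leq m0 gm) (dvdn_leq n0 gn); split=> //.
by rewrite !muln_divA// mulnC.
Qed.

(** The alternatives are connectedness and disconnectedness of the graph whose
edges are the T-close pairs.  A simple path has fewer than #|M| edges, and each
edge multiplies the height by at most T. *)
Lemma cluster_dichotomy (T : nat) (M : {fset nat}) (m0 : nat) :
  (0 < T)%N -> positive_fset M -> m0 \in M ->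
  (forall m, m \in M -> ratio_height_le (T ^ #|` M|) m0 m) \/
  exists A B : {fset nat}, [/\ M = (A `|` B)%fset, [disjoint A & B]%fset,
    (0 < #|` A|)%N, (0 < #|` B|)%N &
    forall a b, a \in A -> b \in B -> ~~ close T a b].
Proof.
move=> T0 M0 m0M; pose x0 : M := [` m0M]%fset.
pose e := [rel x y : M | close T (val x) (val y)].
have hp p x : path e x p -> ratio_height_le (T ^ size p) (val x) (val (last x p)).
  elim: p x => [|y p IH] x /=; first by move=> _; exact: ratio_height_refl.
  move=> /andP[exy py]; rewrite expnS; apply: ratio_height_trans (IH _ py).
  by apply: close_ratio_height; rewrite ?M0// ?fsvalP.
have [all|] := pselect (forall y : M, connect e x0 y).
  left=> m mM; have /connectP[p pp ml] := all [` mM]%fset.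
  have : m = val (last x0 p) by rewrite -ml.
  case/shortenP: pp => q pq uq _ ->; apply: ratio_height_leq (hp _ _ pq).
  apply: leq_pexp2l => //; rewrite cardfE.
  have : (size (x0 :: q) <= #|{: M}|)%N by rewrite -(card_uniqP uq) max_card.
  by move=> /ltnW.
move=> /existsNP[y nxy]; right.
pose A := [fset val x | x in [pred x : M | connect e x0 x]]%fset.
have sAM : (A `<=` M)%fset by apply/fsubsetP => _ /imfsetP[x _ ->]; exact: fsvalP.
exists A, (M `\` A)%fset; split.
- apply/fsetP => x; rewrite in_fsetU in_fsetD; have := fsubsetP sAM x.
  by case: (x \in A) => //= ->.
- by apply/fdisjointP => x xA; rewrite in_fsetD xA.
- rewrite cardfs_gt0; apply/fset0Pn; exists m0; apply/imfsetP; exists x0 => //.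
  exact: connect0.
- rewrite cardfs_gt0; apply/fset0Pn; exists (val y); rewrite inE fsvalP andbT.
  apply/imfsetP => /= -[x]; rewrite inE => cx /val_inj yx.
  by apply: nxy; rewrite yx.
- move=> a b /imfsetP[x /=]; rewrite inE => cx ->; rewrite inE => /andP[bA bM].
  apply: contra bA => cxb; apply/imfsetP; exists [` bM]%fset => //.
  by apply: connect_trans cx _; apply: connect1.
Qed.

(** Every m in M is m0 times a fraction a / b with b <= H, so multiplying M by
H! makes it divisible by m0; the quotient is bounded in terms of H only, and is
linked to M by dilations. *)
Lemma bounded_model (R : realType) (l H m0 : nat) (M : {fset nat}) :
  positive_fset M -> m0 \in M ->
  (forall m, m \in M -> ratio_height_le H m0 m) ->
  exists X : {fset nat}, [/\ positive_fset X, #|` X| = #|` M|,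
    gcd_sum R l X = gcd_sum R l M &
    (X `<=` [fset n in iota 0 (H`! * H).+1])%fset].
Proof.
move=> M0 m0M hM; have m00 := M0 _ m0M.
have H0 : (0 < H`!)%N := fact_gt0 H.
pose f m := (H`! * m %/ m0)%N.
have fP m : m \in M -> (m0 * f m = H`! * m)%N /\ (f m <= H`! * H)%N.
  move=> mM; have [a [b [/andP[a0 aH] /andP[b0 bH] e]]] := hM _ mM.
  have dv : (a %| H`!)%N by apply: dvdn_fact; rewrite a0.
  have E : (H`! * m = m0 * (H`! %/ a * b))%N.
    by rewrite -[in LHS](divnK dv) -mulnA (mulnC a) -e mulnCA.
  rewrite /f E mulKn//; split=> //.
  by rewrite leq_mul// leq_div.
exists [fset f m | m in M]%fset.
have E : dilate m0 [fset f m | m in M]%fset = dilate H`! M.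
  apply/fsetP => x; apply/imfsetP/imfsetP => /=.
    by move=> [_ /imfsetP[m /= mM ->] ->]; exists m => //; rewrite (fP m mM).1.
  move=> [m mM ->]; exists (f m); last by rewrite (fP m mM).1.
  by apply/imfsetP; exists m.
split.
- move=> _ /imfsetP[m /= mM ->]; have := (fP m mM).1; have := M0 m mM.
  case: (f m) => // m_gt0 /esym/eqP; rewrite muln0 muln_eq0.
  by rewrite !gtn_eqF.
- by rewrite -(card_dilate _ m00) E card_dilate.
- by rewrite -(gcd_sum_dilate R l _ m00) E gcd_sum_dilate.
- apply/fsubsetP => _ /imfsetP[m /= mM ->].
  have fm : f m \in iota 0 (H`! * H).+1 by rewrite mem_iota ltnS (fP m mM).2.
  by apply/imfsetP; exists (f m).
Qed.

Lemma seq_argmax (R : realType) (T : eqType) (s : seq T) (P : T -> Prop)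
    (F : T -> R) (x0 : T) : x0 \in s -> P x0 ->
  exists2 x, x \in s & P x /\ forall y, y \in s -> P y -> F y <= F x.
Proof.
elim: s x0 => // z s IH x0; rewrite inE => x0s Px0.
have [[x [xs Px]]|nP] := pselect (exists x, x \in s /\ P x); last first.
  have zx : x0 = z.
    by case/orP: x0s => [/eqP//|x0s]; case: nP; exists x0.
  exists z; first by rewrite mem_head.
  rewrite -{1}zx; split=> // y; rewrite inE => /orP[/eqP->//|ys Py].
  by case: nP; exists y.
have [w ws [Pw wmax]] := IH x xs Px.
have [[Pz zw]|nz] := pselect (P z /\ F w <= F z).
  exists z; first by rewrite mem_head.
  split=> // y; rewrite inE => /orP[/eqP->//|ys Py].
  exact: le_trans (wmax y ys Py) zw.
exists w; first by rewrite inE ws orbT.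
split=> // y; rewrite inE => /orP[/eqP-> Pz|]; last exact: wmax.
by case: (leP (F z) (F w)) => // /ltW zw; case: nz.
Qed.

(** One of the two factors is small since its argument exceeds T, the other is
bounded by l^l. *)
Lemma far_gcd_term_cvg0 (R : realType) (l : nat) (e : R) :
  (0 < l)%N -> 0 < e -> exists2 T : nat, (0 < T)%N &
    forall m n, ~~ close T m n -> gcd_term R l m n <= e.
Proof.
move=> l0 e0; pose C : R := l%:R ^+ l.
have C0 : 0 < C by rewrite exprn_gt0// ltr0n.
have [T hT] := log_weight_cvg0 l (divr_gt0 e0 C0).
exists T.+1 => // m n; rewrite negb_and -!ltnNge /gcd_term => h.
have -> : e = e / C * C by rewrite divfK// gt_eqF.
case/orP: h => /ltnW h.
  by rewrite ler_pM ?log_weight_ge0 ?log_weight_le// hT.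
by rewrite mulrC ler_pM ?log_weight_ge0 ?log_weight_le// hT.
Qed.

(** The set U beats every splitting into two nonempty parts, considered
separately.  If U is not optimal, some V beats it by d > 0; a set at least as
good as V cannot be split at a threshold for which the cross terms contribute
less than d, so it has a model inside a fixed interval. *)
Lemma exists_max_gcd_sum (R : realType) (l N : nat) : (0 < l)%N ->
  exists M : {fset nat}, [/\ positive_fset M, #|` M| = N &
    forall M', positive_fset M' -> #|` M'| = N ->
      gcd_sum R l M' <= gcd_sum R l M].
Proof.
move=> l0; have [n] := ubnP N; elim: n N => // n IH N; rewrite ltnS => Nn.
pose optimal k M := [/\ positive_fset M, #|` M| = k &
    forall M', positive_fset M' -> #|` M'| = k ->
      gcd_sum R l M' <= gcd_sum R l M].
have [F F0 cF] := exists_positive_fset N.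
have [N0|N_gt0] := posnP N.
  exists F; split=> // M' _ cM'.
  suff -> : M' = F by [].
  by move: cM' cF; rewrite N0 => /eqP; rewrite cardfs_eq0 => /eqP-> /eqP;
    rewrite cardfs_eq0 => /eqP ->.
(* For each k, dilates of optimal sets of sizes k and N - k are put together;
   U is the best of these unions. *)
have [U [U0 cU hU]] : exists U : {fset nat}, [/\ positive_fset U, #|` U| = N &
    forall A B, positive_fset A -> positive_fset B ->
      (0 < #|` A|)%N -> (0 < #|` B|)%N -> (#|` A| + #|` B| = N)%N ->
      gcd_sum R l A + gcd_sum R l B <= gcd_sum R l U].
  have split_bound k : exists U : {fset nat}, [/\ positive_fset U, #|` U| = N &
      (0 < k < N)%N ->
      forall A B, positive_fset A -> positive_fset B ->
      #|` A| = k -> #|` B| = (N - k)%N ->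
      gcd_sum R l A + gcd_sum R l B <= gcd_sum R l U].
    have [kN|kN] := boolP (0 < k < N)%N; last by exists F; split=> // /idPn.
    have [k0 ltkN] := andP kN.
    have [A [A0 cA Amax]] := IH k (leq_trans ltkN Nn).
    have [B [B0 cB Bmax]] : exists M, optimal (N - k)%N M.
      by apply: IH; apply: leq_trans Nn; rewrite ltn_subrL k0 N_gt0.
    have [C [C0 cC sC]] := gcd_sum_superadditive R l A0 B0.
    exists C; split=> //; first by rewrite cC cA cB subnKC// ltnW.
    move=> _ A' B' A'0 B'0 cA' cB'; apply: le_trans sC.
    by rewrite lerD ?Amax ?Bmax.
  have [Uk hUk] := choice split_bound.
  have [_ /mapP[k _ ->] [_ Umax]] : exists2 U, U \in [seq Uk k | k <- iota 0 N] &
      True /\ forall V, V \in [seq Uk k | k <- iota 0 N] -> True ->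
        gcd_sum R l V <= gcd_sum R l U.
    apply: (@seq_argmax _ _ _ _ _ (Uk 0%N)) => //.
    by apply: map_f; rewrite mem_iota.
  exists (Uk k); have [? ? _] := hUk k; split=> // A B A0 B0 cA cB cAB.
  have AN : (#|` A| < N)%N by rewrite -cAB -[X in (X < _)%N]addn0 ltn_add2l.
  apply: (@le_trans _ _ (gcd_sum R l (Uk #|` A|))).
    by have [_ _] := hUk #|` A|; apply=> //; rewrite ?cA// -cAB addKn.
  by apply: Umax => //; apply: map_f; rewrite mem_iota.
have [Umax|] := pselect (forall M', positive_fset M' -> #|` M'| = N ->
    gcd_sum R l M' <= gcd_sum R l U); first by exists U.
move=> /existsNP[V /not_implyP[V0 /not_implyP[cV /negP]]]; rewrite -ltNge => UV.
pose d := gcd_sum R l V - gcd_sum R l U.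
have d0 : 0 < d by rewrite subr_gt0.
have NN0 : 0 < (4 * N%:R ^+ 2 : R) by rewrite mulr_gt0// exprn_gt0// ltr0n.
(* The cross terms are counted twice, so N^2 of them of size d / (4 N^2)
   contribute at most d / 2. *)
have [T T0 hT] := far_gcd_term_cvg0 l0 (divr_gt0 d0 NN0).
pose Z := ((T ^ N)`! * (T ^ N)).+1.
pose box : {fset nat} := [fset n in iota 0 Z]%fset.
have model M : positive_fset M -> #|` M| = N -> gcd_sum R l V <= gcd_sum R l M ->
    exists X, [/\ X \in fpowerset box, positive_fset X /\ #|` X| = N &
      gcd_sum R l X = gcd_sum R l M].
  move=> M0 cM VM.
  have [m0 m0M] : exists m0, m0 \in M.
    by apply/fset0Pn; rewrite -cardfs_gt0 cM.
  case: (cluster_dichotomy T0 M0 m0M) => [hM|[A [B [MAB dAB cA cB far]]]].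
    have [X [X0 cX sX Xbox]] := bounded_model R l M0 m0M hM.
    exists X; rewrite fpowersetE; split=> //; last by rewrite cX.
    by rewrite /box /Z -cM.
  exfalso; move: VM; apply/negP; rewrite -ltNge MAB gcd_sumU//.
  have cAB : (#|` A| + #|` B| = N)%N by rewrite -cardfsU_disjoint// -MAB.
  have A0 : positive_fset A by move=> a aA; apply: M0; rewrite MAB inE aA.
  have B0 : positive_fset B by move=> b bB; apply: M0; rewrite MAB inE bB orbT.
  have sAB := hU A B A0 B0 cA cB cAB.
  have cross : \sum_(a <- A) \sum_(b <- B) gcd_term R l a b <= d / 4.
    have -> : d / 4 = N%:R * (N%:R * (d / (4 * N%:R ^+ 2))).
      rewrite [RHS]mulrA -expr2 invfM [RHS]mulrCA [X in _ = d * X]mulrCA.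
      by rewrite mulfV ?mulr1// expf_neq0// pnatr_eq0 -lt0n.
    have e0 : 0 <= d / (4 * N%:R ^+ 2) by rewrite divr_ge0// ltW.
    have const (C : {fset nat}) (x : R) : 0 <= x -> (#|` C| <= N)%N ->
        \sum_(c <- C) x <= N%:R * x.
      move=> x0 CN; rewrite big_const_seq count_predT iter_addr_0 -[leLHS]mulr_natl.
      by rewrite ler_wpM2r// ler_nat.
    apply: le_trans (const A _ _ _); last 2 first.
    - by rewrite mulr_ge0.
    - by rewrite -cAB leq_addr.
    rewrite big_seq [leRHS]big_seq; apply: ler_sum => a aA.
    apply: le_trans (const B _ e0 _); last by rewrite -cAB leq_addl.
    by rewrite big_seq [leRHS]big_seq; apply: ler_sum => b bB; apply/hT/far.
  have dE : d = gcd_sum R l V - gcd_sum R l U by [].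
  lra.
have [X Xs [[X0 cX] Xmax]] : exists2 X, X \in (fpowerset box : seq _) &
    (positive_fset X /\ #|` X| = N) /\
    forall Y, Y \in (fpowerset box : seq _) -> positive_fset Y /\ #|` Y| = N ->
      gcd_sum R l Y <= gcd_sum R l X.
  have [X [Xs XN _]] := model V V0 cV (lexx _).
  exact: (@seq_argmax _ _ _ _ _ X).
exists X; split=> // M M0 cM.
have {}model M' : positive_fset M' -> #|` M'| = N ->
    gcd_sum R l V <= gcd_sum R l M' -> gcd_sum R l M' <= gcd_sum R l X.
  by move=> M'0 cM' /(model _ M'0 cM')[Y [Ys YN <-]]; exact: Xmax.
have [VM|/ltW MV] := leP (gcd_sum R l V) (gcd_sum R l M); first exact: model.
by apply: le_trans MV _; apply: model.
Qed.

(** * Boxes of smooth numbers *)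

Definition small_prime (y : nat) : finType := {p in [pred p : 'I_y.+1 | prime p]}.

Definition box_elt (y E : nat) (f : {ffun small_prime y -> 'I_E}) : nat :=
  (\prod_(p : small_prime y) val (val p) ^ f p)%N.

Definition prime_box (y E : nat) : {fset nat} :=
  [fset box_elt f | f in {: {ffun small_prime y -> 'I_E}}]%fset.

Lemma small_prime_prime (y : nat) (p : small_prime y) : prime (val (val p)).
Proof. exact: (valP p). Qed.

(** Zero is the element of 'I_y.+1 that is discarded. *)
Lemma card_small_prime (y : nat) : (#|small_prime y| <= y)%N.
Proof.
rewrite card_sig; apply: (@leq_trans #|predC1 (ord0 : 'I_y.+1)|).
  apply: subset_leq_card; apply/fintype.subsetP => p; rewrite !inE => pp.
  by apply: contraL pp => /eqP ->.
by rewrite cardC1 card_ord.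
Qed.

Lemma prime_box_gt0 (y E : nat) : positive_fset (prime_box y E).
Proof.
move=> _ /imfsetP[f _ ->]; apply: prodn_gt0 => p.
by rewrite expn_gt0 prime_gt0// small_prime_prime.
Qed.

(** Unique factorisation: the exponents are recovered as valuations, so the box
has exactly E ^ r elements, r being the number of primes up to y. *)
Lemma logn_box_elt (y E : nat) (f : {ffun small_prime y -> 'I_E})
    (q : small_prime y) : logn (val (val q)) (box_elt f) = f q.
Proof.
have [_ ->] : (0 < box_elt f)%N /\ logn (val (val q)) (box_elt f)
    = (\sum_(p : small_prime y) logn (val (val q)) (val (val p) ^ f p))%N.
  apply: (big_ind2 (fun m s => 0 < m /\ logn (val (val q)) m = s)%N).
  - by rewrite logn1.
  - by move=> m s n t [m0 <-] [n0 <-]; rewrite lognM// muln_gt0 m0.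
  - by move=> p _; rewrite expn_gt0 prime_gt0// small_prime_prime.
rewrite (bigD1 q)//= big1 => [|p pq].
  by rewrite addn0 lognX logn_prime ?small_prime_prime// eqxx muln1.
rewrite lognX logn_prime ?small_prime_prime//.
by rewrite eq_sym (inj_eq val_inj) (inj_eq val_inj) (negPf pq) muln0.
Qed.

Lemma card_prime_box (y E : nat) :
  #|` prime_box y E| = (E ^ #|small_prime y|)%N.
Proof.
rewrite card_imfset/=; first by rewrite -cardE card_ffun card_ord.
move=> f g fg; apply/ffunP => q; apply: ord_inj.
by rewrite -!logn_box_elt fg.
Qed.

Lemma prod_small_prime_logn (y a : nat) : (0 < a <= y)%N ->
  (\prod_(p : small_prime y) val (val p) ^ logn (val (val p)) a)%N = a.
Proof.
move=> /andP[a0 ay].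
rewrite -(big_sub [pred p : 'I_y.+1 | prime p]
  (fun p : 'I_y.+1 => val p ^ logn (val p) a)%N).
rewrite -[RHS](partnT a0) (widen_partn predT ay) big_mkord big_mkcond/=.
apply: eq_bigr => p _; rewrite inE; case: ifP => // /negbT np.
by rewrite lognE (negPf np).
Qed.

(** The valuations of a <= y are smaller than a, hence at most y. *)
Lemma mul_prime_box (y E a m : nat) : (0 < a <= y)%N ->
  m \in prime_box y E -> (m * a)%N \in prime_box y (E + y).
Proof.
move=> ay /imfsetP[f _ ->].
have lt p : (f p + logn (val (val p)) a < E + y)%N.
  have [a0 a_le] := andP ay.
  have := ltn_ord (f p); have := ltn_logl (val (val p)) a0; lia.
apply/imfsetP; exists [ffun p => Ordinal (lt p)] => //.
rewrite -{1}(prod_small_prime_logn ay) /box_elt -big_split/=.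
by apply: eq_bigr => p _; rewrite ffunE expnD.
Qed.

Definition coprime_sum (R : realType) (l y : nat) : R :=
  \sum_(1 <= a < y.+1) \sum_(1 <= b < y.+1 | coprime a b)
    log_weight R l a * log_weight R l b.

(** The triple (m, a, b) is recovered from (m a, m b), as m is the gcd of the
two entries; the terms of the pairs so obtained are f(a) f(b). *)
Lemma gcd_sum_ge_coprime_sum (R : realType) (l y : nat) (A B : {fset nat}) :
  positive_fset A ->
  (forall m a, m \in A -> (0 < a <= y)%N -> (m * a)%N \in B) ->
  #|` A|%:R * coprime_sum R l y <= gcd_sum R l B.
Proof.
move=> A0 AB.
pose cop := [seq ab <- [seq (a, b) | a <- index_iota 1 y.+1, b <- index_iota 1 y.+1]
  | coprime ab.1 ab.2].
pose mul (t : nat * (nat * nat)) := ((t.1 * t.2.1)%N, (t.1 * t.2.2)%N).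
pose dom := [seq (m, ab) | m <- A : seq nat, ab <- cop].
have copP a b : (a, b) \in cop -> [/\ (0 < a <= y)%N, (0 < b <= y)%N & coprime a b].
  rewrite mem_filter /= => /andP[cab /allpairsP[[c d] /= [cy dy [ac bd]]]].
  by move: cy dy cab; rewrite -ac -bd !mem_index_iota !ltnS => -> -> ->.
have domP t : t \in dom -> t.1 \in A /\ t.2 \in cop.
  by move=> /allpairsP[[m ab] /= [mA abc ->]].
have mul_inj : {in dom &, injective mul}.
  move=> [m [a b]] [n [c d]].
  move=> /domP[/= mA /copP[_ _ cab]] /domP[/= nA /copP[_ _ ccd]].
  move=> [e1 e2].
  have mn : m = n.
    have : gcdn (m * a) (m * b) = gcdn (n * c) (n * d) by rewrite e1 e2.
    by rewrite -!muln_gcdr (eqP cab) (eqP ccd) !muln1.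
  move: e1 e2; rewrite -mn => /eqP; rewrite eqn_pmul2l ?A0// => /eqP ->.
  by move=> /eqP; rewrite eqn_pmul2l ?A0// => /eqP ->.
have uniq_cop : uniq cop.
  apply: filter_uniq; apply: allpairs_uniq; rewrite ?iota_uniq//.
  by move=> [? ?] [? ?] _ _ [-> ->].
have uniq_dom : uniq dom.
  apply: allpairs_uniq; rewrite ?fset_uniq//.
  by move=> [? ?] [? ?] _ _ [-> ->].
have -> : gcd_sum R l B = \sum_(uv <- [seq (u, v) | u <- B : seq nat, v <- B : seq nat])
    gcd_term R l uv.1 uv.2 by rewrite big_allpairs.
apply: (@le_trans _ _ (\sum_(uv <- map mul dom) gcd_term R l uv.1 uv.2)); last first.
  apply: ler_sum_subseq.
  - by rewrite map_inj_in_uniq.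
  - apply: allpairs_uniq; rewrite ?fset_uniq//.
    by move=> [? ?] [? ?] _ _ [-> ->].
  - move=> _ /mapP[[m [a b]] /domP[/= mA /copP[ay bY _]] ->].
    by apply/allpairsP; exists ((m * a)%N, (m * b)%N); split=> //=; apply: AB.
  - by move=> x _; exact: gcd_term_ge0.
rewrite big_map big_allpairs/=.
rewrite [leRHS](_ : _ = \sum_(m <- A) coprime_sum R l y); last first.
  rewrite big_seq [RHS]big_seq; apply: eq_bigr => m mA.
  rewrite /cop big_filter big_mkcond big_allpairs/= /coprime_sum.
  apply: eq_bigr => a _; rewrite [RHS]big_mkcond/=.
  apply: eq_bigr => b _; case: ifP => // cab.
  by rewrite gcd_term_scale ?A0// gcd_term_coprime.
by rewrite big_const_seq count_predT iter_addr_0 mulr_natl.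
Qed.

(** * Coprime pairs up to y *)

(** These two bounds are the mean value estimates for t^(n+1); they replace the
comparison of sums of log^l(k) / k with an integral. *)
Lemma subrXX_le (R : realType) (n : nat) (u v : R) : 0 <= u <= v ->
  v ^+ n.+1 - u ^+ n.+1 <= n.+1%:R * v ^+ n * (v - u).
Proof.
move=> /andP[u0 uv]; have v0 := le_trans u0 uv.
elim: n => [|n IH]; first by rewrite !expr1 expr0; lra.
have -> : v ^+ n.+2 - u ^+ n.+2
    = v * (v ^+ n.+1 - u ^+ n.+1) + u ^+ n.+1 * (v - u).
  by rewrite (exprS v n.+1) (exprS u n.+1); lra.
have -> : n.+2%:R * v ^+ n.+1 * (v - u)
    = v * (n.+1%:R * v ^+ n * (v - u)) + v ^+ n.+1 * (v - u).
  by rewrite (exprS v n) -(natr1 n.+1); lra.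
by rewrite lerD ?ler_wpM2l// ler_wpM2r ?subr_ge0// lerXn2r.
Qed.

Lemma subrXX_ge (R : realType) (n : nat) (u v : R) : 0 <= u <= v ->
  n.+1%:R * u ^+ n * (v - u) <= v ^+ n.+1 - u ^+ n.+1.
Proof.
move=> /andP[u0 uv]; have v0 := le_trans u0 uv.
elim: n => [|n IH]; first by rewrite !expr1 expr0; lra.
have -> : v ^+ n.+2 - u ^+ n.+2
    = u * (v ^+ n.+1 - u ^+ n.+1) + v ^+ n.+1 * (v - u).
  by rewrite (exprS v n.+1) (exprS u n.+1); lra.
have -> : n.+2%:R * u ^+ n.+1 * (v - u)
    = u * (n.+1%:R * u ^+ n * (v - u)) + u ^+ n.+1 * (v - u).
  by rewrite (exprS u n) -(natr1 n.+1); lra.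
by rewrite lerD ?ler_wpM2l// ler_wpM2r ?subr_ge0// lerXn2r.
Qed.

Lemma ln_succ_le (R : realType) (k : nat) : (0 < k)%N ->
  ln (k.+1%:R : R) - ln k%:R <= k%:R^-1.
Proof.
move=> k0; have kp : 0 < (k%:R : R) by rewrite ltr0n.
rewrite -ln_div ?posrE// -natr1 mulrDl divff ?gt_eqF// mul1r.
by apply: le_ln1Dx; apply: lt_trans (_ : 0 < _); rewrite ?invr_gt0// ltrN10.
Qed.

Lemma ln_succ_ge (R : realType) (k : nat) : (0 < k)%N ->
  k.+1%:R^-1 <= ln (k.+1%:R : R) - ln k%:R.
Proof.
move=> k0; have kp : 0 < (k%:R : R) by rewrite ltr0n.
have k1 : 0 < (k.+1%:R : R) by [].
rewrite -opprB -ln_div ?posrE// lerNr.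
have -> : k%:R / k.+1%:R = 1 + - k.+1%:R^-1 :> R.
  have k1n : k.+1%:R != 0 :> R by rewrite gt_eqF.
  by apply: (mulIf k1n); rewrite divfK// mulrDl mulNr mulVf// mul1r -natr1 addrK.
by apply: le_ln1Dx; rewrite ltrN2 invf_lt1// ltr1n.
Qed.

(** Telescoping log^(l+1): its increment from y to y + 1 is at most
(l+1) log^l(y+1) / y.  Replacing 1/y by 1/(y+1) costs log^l(y+1) / (y (y+1)),
and these losses telescope against log^l(y) (1 - 1/y). *)
Lemma sum_log_weight_ge (R : realType) (l y : nat) : (0 < y)%N ->
  ln (y%:R : R) ^+ l.+1 / l.+1%:R - ln y%:R ^+ l
    <= \sum_(1 <= a < y.+1) log_weight R l a.
Proof.
move=> y0; suff : ln (y%:R : R) ^+ l.+1 / l.+1%:R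
    <= \sum_(1 <= a < y.+1) log_weight R l a + ln y%:R ^+ l * (1 - y%:R^-1).
  have : 0 <= ln (y%:R : R) ^+ l * y%:R^-1 by rewrite mulr_ge0// exprn_ge0// ln_nat_ge0.
  rewrite mulrBr mulr1; set s := \sum_(_ <= _ < _) _.
  set x := _ ^+ l.+1 / _; set e := _ ^+ l / _.
  move: s x e (_ ^+ l).
  by move=> s x e z; lra.
case: y y0 => // y _; elim: y => [|y IH].
  by rewrite big_nat1 ln1 expr0n mul0r addr_ge0// ?log_weight_ge0// invr1 subrr mulr0.
rewrite big_nat_recr//=; set S := \sum_(_ <= _ < _) _ in IH *.
set u := ln (y.+1%:R : R) in IH *; set v := ln (y.+2%:R : R).
have uv : 0 <= u <= v by rewrite ln_nat_ge0 ln_nat_le.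
have v0 : 0 <= v ^+ l by rewrite exprn_ge0// ln_nat_ge0.
have step : v ^+ l.+1 / l.+1%:R - u ^+ l.+1 / l.+1%:R <= v ^+ l * y.+1%:R^-1.
  rewrite -mulrBl ler_pdivrMr// -mulrA mulrC.
  apply: le_trans (subrXX_le l uv) _.
  by rewrite mulrAC ler_wpM2r// mulrC ler_wpM2r// ln_succ_le.
have ulv : u ^+ l <= v ^+ l.
  by case/andP: uv => u0 uv; rewrite lerXn2r// nnegrE// (le_trans u0).
have y1 : 0 <= 1 - (y.+1%:R^-1 : R).
  by rewrite subr_ge0 invf_le1// ler1n.
have := ler_wpM2r y1 ulv; rewrite /log_weight -/v; move: IH step.
move: (l.+1%:R^-1 : R) (y.+1%:R^-1 : R) (y.+2%:R^-1 : R) => w p q.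
by move: (u ^+ l) (v ^+ l) (u ^+ l.+1) (v ^+ l.+1) => a b c d; lra.
Qed.

(** Here the increment of log^(l+1)(d k)/(l+1) from K to K + 1 is at least
log^l(d K) / (K + 1); the shift from K + 1 to K in the argument is paid by the
increment of log^l.  The bound is uniform in d. *)
Lemma sum_log_weight_mul_le (R : realType) (l d K : nat) :
  (0 < d)%N -> (0 < K)%N ->
  \sum_(1 <= k < K.+1) ln ((d * k)%:R : R) ^+ l / k%:R
    <= ln (d * K)%:R ^+ l.+1 / l.+1%:R + ln (d * K)%:R ^+ l.
Proof.
move=> d0; case: K => // K _; elim: K => [|K IH].
  by rewrite big_nat1 invr1 mulr1 lerDr divr_ge0// exprn_ge0// ln_nat_ge0.
rewrite big_nat_recr//=; set S := \sum_(_ <= _ < _) _ in IH *.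
have lnM k : (0 < k)%N -> ln ((d * k)%:R : R) = ln d%:R + ln k%:R.
  by move=> k0; rewrite natrM lnM// posrE ltr0n.
have vu : ln ((d * K.+2)%:R : R) - ln (d * K.+1)%:R = ln K.+2%:R - ln K.+1%:R.
  by rewrite !lnM//; lra.
set u := ln ((d * K.+1)%:R : R) in IH vu *; set v := ln ((d * K.+2)%:R : R) in vu *.
have uv : 0 <= u <= v by rewrite ln_nat_ge0 ln_nat_le ?muln_gt0 ?d0// leq_mul.
have u0 : 0 <= u ^+ l by rewrite exprn_ge0// ln_nat_ge0.
have step : u ^+ l * K.+2%:R^-1 <= v ^+ l.+1 / l.+1%:R - u ^+ l.+1 / l.+1%:R.
  rewrite -mulrBl ler_pdivlMr// mulrC.
  apply: le_trans (subrXX_ge l uv); rewrite vu mulrA.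
  by rewrite ler_wpM2l ?mulr_ge0// ln_succ_ge.
have ulv : u ^+ l <= v ^+ l.
  by case/andP: uv => u00 uv; rewrite lerXn2r// nnegrE// (le_trans u00).
have K1 : 0 <= 1 - (K.+2%:R^-1 : R) by rewrite subr_ge0 invf_le1// ler1n.
have := ler_wpM2r K1 ulv; move: IH step.
move: (l.+1%:R^-1 : R) (K.+2%:R^-1 : R) => w q.
by move: (u ^+ l) (v ^+ l) (u ^+ l.+1) (v ^+ l.+1) => a b c e; lra.
Qed.

Lemma big_nat_dvdn (R : realType) (d y : nat) (F : nat -> R) : (0 < d)%N ->
  \sum_(1 <= a < y.+1 | (d %| a)%N) F a = \sum_(1 <= k < (y %/ d).+1) F (d * k)%N.
Proof.
move=> d0; elim: y => [|y IH]; first by rewrite div0n !big_geq.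
rewrite big_mkcond big_nat_recr//= -big_mkcond/= IH.
have := divnS y d0; case: ifP => dy /=; last by rewrite add0n addr0 => ->.
by rewrite add1n => e; rewrite e [RHS]big_nat_recr//= -e mulnC divnK.
Qed.

Lemma sum_dvd_log_weight_le (R : realType) (l d y : nat) : (0 < d)%N -> (0 < y)%N ->
  \sum_(1 <= a < y.+1 | (d %| a)%N) log_weight R l a
    <= d%:R^-1 * (ln (y%:R : R) ^+ l.+1 / l.+1%:R + ln y%:R ^+ l).
Proof.
move=> d0 y0; rewrite big_nat_dvdn//.
have [K0|K0] := posnP (y %/ d).
  by rewrite K0 big_geq// mulr_ge0// addr_ge0 ?divr_ge0 ?exprn_ge0 ?ln_nat_ge0.
under eq_bigr => k _ do rewrite /log_weight [in X in _ / X]natrM invfM mulrCA.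
rewrite -mulr_sumr ler_wpM2l//.
apply: le_trans (sum_log_weight_mul_le R l d0 K0) _.
have h : ln ((d * (y %/ d))%:R : R) <= ln y%:R.
  by rewrite ln_nat_le ?muln_gt0 ?d0// mulnC leq_trunc_div.
by rewrite lerD ?ler_wpM2r// lerXn2r ?nnegrE ?ln_nat_ge0.
Qed.

(** The moduli 2, 3, 5, 7, 9, ...: they contain all primes, and unlike the
primes they have an elementary bound for the sum of the inverse squares. *)
Definition sieve_modulus (j : nat) : nat := if j is 0%N then 2 else j.*2.+1.

Lemma sieve_modulus_gt0 (j : nat) : (0 < sieve_modulus j)%N.
Proof. by case: j. Qed.

(** The odd moduli telescope, since (2 j + 1)^2 >= 4 j (j + 1); they account for
at most 1/4, and the modulus 2 for the other 1/4. *)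
Lemma sum_sieve_modulus (R : realType) (n : nat) :
  \sum_(0 <= j < n) ((sieve_modulus j)%:R ^+ 2)^-1 <= 2^-1 :> R.
Proof.
case: n => [|n]; first by rewrite big_geq.
suff : \sum_(0 <= j < n.+1) ((sieve_modulus j)%:R ^+ 2)^-1
    <= 2^-1 - (4 * n.+1%:R)^-1 :> R.
  by move=> /le_trans; apply; rewrite gerBl invr_ge0 mulr_ge0.
elim: n => [|n IH]; first by rewrite big_nat1 /sieve_modulus; lra.
rewrite big_nat_recr//=; set S := \sum_(_ <= _ < _) _ in IH *.
have x0 : 0 < (n.+1%:R : R) by []. 
have -> : ((n.+1).*2.+1%:R : R) = 2 * n.+1%:R + 1.
  by rewrite -natr1 -muln2 natrM mulrC.
have -> : (n.+2%:R : R) = n.+1%:R + 1 by rewrite natr1.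
move: (n.+1%:R : R) x0 IH => x x0 IH.
apply: (@le_trans _ _ (S + (4 * x * (x + 1))^-1)).
  rewrite lerD2l lef_pV2 ?posrE ?exprn_gt0 ?mulr_gt0 ?addr_gt0 ?mulr_gt0//.
  by rewrite expr2; lra.
have -> : (4 * x * (x + 1))^-1 = (4 * x)^-1 - (4 * (x + 1))^-1.
  have x1 : x + 1 != 0 by rewrite gt_eqF// addr_gt0.
  have xn : x != 0 by rewrite gt_eqF.
  rewrite !invfM.
  have e1 : x^-1 = x^-1 * ((x + 1) * (x + 1)^-1) by rewrite divff// mulr1.
  have e2 : (x + 1)^-1 = (x + 1)^-1 * (x * x^-1) by rewrite divff// mulr1.
  by move: (x^-1) ((x + 1)^-1) e1 e2 => p q; lra.
lra.
Qed.

(** Take a common prime factor p: the index is 0 if p = 2 and p./2 otherwise. *)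
Lemma noncoprime_sieve (a b : nat) : (0 < a)%N -> ~~ coprime a b ->
  exists2 j, (j < a.+1)%N & (sieve_modulus j %| a)%N && (sieve_modulus j %| b)%N.
Proof.
move=> a0 nc; pose p := pdiv (gcdn a b).
have g0 : (0 < gcdn a b)%N by rewrite gcdn_gt0 a0.
have pp : prime p.
  by apply: pdiv_prime; rewrite ltn_neqAle eq_sym nc.
have pa : (p %| a)%N := dvdn_trans (pdiv_dvd _) (dvdn_gcdl a b).
have pb : (p %| b)%N := dvdn_trans (pdiv_dvd _) (dvdn_gcdr a b).
have [p2|podd] := even_prime pp; first by exists 0%N; rewrite /sieve_modulus -?p2 ?pa ?pb.
have pE : sieve_modulus p./2 = p.
  have := odd_double_half p; rewrite podd add1n => e.
  case h : p./2 e => [|k] e; last exact: e.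
  by move: pp; rewrite -e.
exists p./2; last by rewrite pE pa pb.
by rewrite ltnS; apply: leq_trans (dvdn_leq a0 pa); lia.
Qed.

(** A union bound: the square of the full sum exceeds the sum over coprime pairs
by at most the contributions of the pairs divisible by some sieve modulus. *)
Lemma coprime_sum_ge (R : realType) (l y : nat) : (0 < y)%N ->
  (\sum_(1 <= a < y.+1) log_weight R l a) ^+ 2
    - 2^-1 * (ln (y%:R : R) ^+ l.+1 / l.+1%:R + ln y%:R ^+ l) ^+ 2
  <= coprime_sum R l y.
Proof.
move=> y0; set S := \sum_(_ <= _ < _) _; set B := _ / _ + _.
have f0 := log_weight_ge0 R l.
pose T d := \sum_(1 <= a < y.+1 | (d %| a)%N) log_weight R l a.
have B0 : 0 <= B by rewrite /B addr_ge0 ?divr_ge0 ?exprn_ge0 ?ln_nat_ge0.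
have bound : S ^+ 2 - coprime_sum R l y
    <= \sum_(0 <= j < y.+1) T (sieve_modulus j) ^+ 2.
  have -> : \sum_(0 <= j < y.+1) T (sieve_modulus j) ^+ 2
      = \sum_(1 <= a < y.+1) \sum_(1 <= b < y.+1) \sum_(0 <= j < y.+1)
          (if (sieve_modulus j %| a)%N && (sieve_modulus j %| b)%N
           then log_weight R l a * log_weight R l b else 0).
    have sqr d : T d ^+ 2 = \sum_(1 <= a < y.+1) \sum_(1 <= b < y.+1)
        (if (d %| a)%N && (d %| b)%N
         then log_weight R l a * log_weight R l b else 0).
      rewrite expr2 {1}/T mulr_suml big_mkcond; apply: eq_bigr => a _.
      case: ifP => _ /=; last by rewrite big1.
      by rewrite /T mulr_sumr big_mkcond.
    under eq_bigr do rewrite sqr.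
    by rewrite exchange_big/=; apply: eq_bigr => a _; rewrite exchange_big.
  rewrite expr2 {1}/S mulr_suml /coprime_sum -sumrB.
  rewrite big_nat [leRHS]big_nat; apply: ler_sum => a /andP[a0 ay].
  rewrite mulr_sumr [X in _ - X]big_mkcond/= -sumrB.
  apply: ler_sum => b _; case: ifPn => [_|nc].
    rewrite subrr; apply: sumr_ge0 => j _; case: ifP => // _; exact: mulr_ge0.
  rewrite subr0; have [j ja jab] := noncoprime_sieve a0 nc.
  rewrite (big_rem j)/=; last by rewrite mem_index_iota (leq_trans ja).
  rewrite jab lerDl; apply: sumr_ge0 => i _; case: ifP => // _; exact: mulr_ge0.
have : \sum_(0 <= j < y.+1) T (sieve_modulus j) ^+ 2 <= 2^-1 * B ^+ 2.
  apply: le_trans (ler_wpM2r (exprn_ge0 2 B0) (sum_sieve_modulus R y.+1)).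
  rewrite mulr_suml; apply: ler_sum => j _; rewrite -exprVn -exprMn.
  rewrite lerXn2r ?nnegrE ?mulr_ge0// ?sumr_ge0//.
  exact: sum_dvd_log_weight_le (sieve_modulus_gt0 j) y0.
lra.
Qed.

(** * Numerical constants *)

(** The sequence defining the constant decreases from its first index on.  At
index 0 its value is 0 and not an upper bound, which is why a shifted sequence
is used. *)
Lemma euler_gamma_le (R : realType) (n : nat) : (0 < n)%N ->
  euler_gamma R <= \sum_(1 <= k < n.+1) (k%:R : R)^-1 - ln n%:R.
Proof.
move=> n0; pose u (m : nat) : R := \sum_(1 <= k < m.+1) k%:R^-1 - ln m%:R.
have u_ge0 m : (0 < m)%N -> 0 <= u m.
  move=> m0; suff : ln (m.+1%:R : R) <= \sum_(1 <= k < m.+1) k%:R^-1.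
    by rewrite subr_ge0; apply: le_trans; apply: ln_nat_le.
  elim: m {m0} => [|m IH]; first by rewrite big_geq// ln1.
  rewrite big_nat_recr//= -lerBlDr; apply: le_trans IH.
  by rewrite lerBlDr -lerBlDl ln_succ_le.
have u_dec : nonincreasing_seq (fun m => u (m + n)%N).
  apply/nonincreasing_seqP => m; rewrite addSn /u big_nat_recr//=.
  have mn0 : (0 < m + n)%N by rewrite addn_gt0 n0 orbT.
  have := ln_succ_ge R mn0; move: ((m + n).+1%:R^-1 : R) => q; lra.
have u_cvg : cvgn (fun m => u (m + n)%N).
  apply: nonincreasing_is_cvgn => //.
  by exists 0 => _ [m _ <-]; apply: u_ge0; rewrite addn_gt0 n0 orbT.
have -> : euler_gamma R = limn (fun m => u (m + n)%N).
  apply: cvg_lim => //; rewrite -(cvg_shiftn n).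
  exact: u_cvg.
exact: (nonincreasing_cvgn_ge u_dec u_cvg 0%N).
Qed.

(** Index 4 of the sequence gives gamma <= 25/12 - log 4, whence the bound
e^(25/6) / 16; and e^(1/12) <= 12/11 follows from e^(-1/12) >= 11/12. *)
Lemma expR_2gamma_le (R : realType) : expR (2 * euler_gamma R) <= 81 / 16.
Proof.
have e12 : expR (12^-1 : R) <= 12 / 11.
  have h : 11 / 12 <= expR (- 12^-1 : R) by apply: le_trans (expR_ge1Dx _); lra.
  have := ler_wpM2l (expR_ge0 (12^-1 : R)) h; rewrite expRxMexpNx_1; lra.
(* (12/11)^50 <= 81, in two stages to keep the numbers small *)
have p10 : expR (12^-1 : R) ^+ 10 <= 12 / 5.
  apply: (@le_trans _ _ ((12 / 11) ^+ 10)); last by lra.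
  by rewrite lerXn2r ?nnegrE ?expR_ge0//; lra.
have p50 : expR (25 / 6 : R) <= 81.
  have -> : 25 / 6 = 10%:R * (5%:R * 12^-1) :> R by lra.
  rewrite mulrCA expRM_natl expRM_natl.
  apply: (@le_trans _ _ ((12 / 5) ^+ 5)); last by lra.
  by rewrite lerXn2r ?nnegrE ?exprn_ge0 ?expR_ge0//; lra.
have ln4 : expR (2 * ln 4) = 16 :> R.
  by rewrite expRM_natl lnK ?posrE//; lra.
have := euler_gamma_le R (isT : 0 < 4)%N.
rewrite big_nat_recr//= big_nat_recr//= big_nat_recr//= big_nat1 => g.
apply: (@le_trans _ _ (expR (25 / 6 - 2 * ln 4))).
  by rewrite ler_expR; lra.
by rewrite expRB ln4 ler_pM2r.
Qed.

(** The tripling formula at pi/6 forces sin(pi/6) = 1/2, and sin x <= x. *)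
Lemma pi_ge3 (R : realType) : 3 <= pi :> R.
Proof.
pose x : R := pi / 6; have pi0 := pi_gt0 R.
have s3 : sin (3 * x) = 1.
  have -> : 3 * x = pi / 2 by rewrite /x; lra.
  exact: sin_pihalf.
have c2 := cos2Dsin2 x.
have : sin (3 * x) = 3 * sin x - 4 * sin x ^+ 3.
  have -> : 3 * x = x + (x + x) by lra.
  rewrite !sinD !cosD; move: c2; set s := sin x; set c := cos x => c2.
  have cc : c ^+ 2 = 1 - s ^+ 2 by lra.
  have -> : s * (c * c - s * s) + c * (s * c + c * s) = 3 * s * c ^+ 2 - s ^+ 3 by lra.
  by rewrite cc; lra.
rewrite s3 => e; have s0 : 0 <= sin x.
  by apply: sin_ge0_pi; rewrite /x; apply/andP; split; lra.
have sE : sin x = 2^-1.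
  (* 1 - 3 s + 4 s^3 = (s + 1) (2 s - 1)^2 *)
  have : (sin x + 1) * (2 * sin x - 1) ^+ 2 = 0 by nra.
  by move/eqP; rewrite mulf_eq0 sqrf_eq0 => /orP[/eqP|/eqP]; lra.
have : sin x <= x.
  have x0 : 0 <= x by rewrite /x; lra.
  have [c _] : exists2 c, c \in `[0, x] & sin x - sin 0 = cos c * (x - 0).
    by apply: MVT_segment => // z; apply: continuous_subspaceT; exact: continuous_sin.
  by rewrite sin0 !subr0 => ->; rewrite ler_piMl// cos_le1.
by rewrite sE /x; lra.
Qed.

(** For l >= 2 it suffices to bound (2l+1)^(2l) below by 4^l l^(2l). *)
Lemma ratio_pow_le (l : nat) : (0 < l)%N ->
  (27 * l ^ (2 * l) * l.+1 ^ 2 <= 4 * (2 * l + 1) ^ (2 * l + 1))%N.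
Proof.
case: l => // -[//|l] _.
have h : (27 * l.+3 ^ 2 <= 4 * 4 ^ l.+2 * (2 * l.+2 + 1))%N.
  elim: l => // l IH; rewrite (expnS 4 l.+2).
  apply: (@leq_trans (4 * (27 * l.+3 ^ 2))); first by rewrite !expnS expn0; nia.
  have := leq_mul (leqnn 4) IH; move: (4 ^ l.+2)%N => q; nia.
have -> : (27 * l.+2 ^ (2 * l.+2) * l.+3 ^ 2 = l.+2 ^ (2 * l.+2) * (27 * l.+3 ^ 2))%N.
  by rewrite mulnCA mulnA.
apply: leq_trans (leq_mul (leqnn _) h) _.
have -> : (l.+2 ^ (2 * l.+2) * (4 * 4 ^ l.+2 * (2 * l.+2 + 1))
   = 4 * ((2 * l.+2) ^ (2 * l.+2) * (2 * l.+2 + 1)))%N.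
  rewrite expnMn (expnM 2 2) -[(2 ^ 2)%N]/4%N.
  by move: (l.+2 ^ _)%N (4 ^ _)%N => a q; lia.
rewrite leq_mul2l addn1; have : (0 < 2 * l.+2)%N by [].
by move: (2 * l.+2)%N => e e0; rewrite expnSr leq_mul ?orbT// leq_exp2r.
Qed.

Lemma gamma_constant_le (R : realType) (l : nat) : (0 < l)%N ->
  6 * expR (2 * euler_gamma R) * (pi ^+ 2)^-1
    * l%:R ^+ (2 * l) * ((2 * l + 1)%:R ^+ (2 * l + 1))^-1
  <= 2^-1 * (l.+1%:R ^+ 2)^-1.
Proof.
move=> l0; have g := expR_2gamma_le R; have p3 := pi_ge3 R.
set D : R := (2 * l + 1)%:R ^+ (2 * l + 1).
have D0 : 0 < D by rewrite exprn_gt0// ltr0n addn1.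
have l1 : 0 < (l.+1%:R ^+ 2 : R) by rewrite exprn_gt0.
have pi2 : (pi ^+ 2)^-1 <= 9^-1 :> R.
  rewrite lef_pV2 ?posrE ?exprn_gt0 ?pi_gt0//; nra.
have num : 27 * l%:R ^+ (2 * l) * l.+1%:R ^+ 2 <= 4 * D.
  by rewrite /D -!natrX -!natrM ler_nat ratio_pow_le.
apply: (@le_trans _ _ (27 / 8 * l%:R ^+ (2 * l) * D^-1)).
  rewrite ler_wpM2r ?invr_ge0 ?(ltW D0)// ler_wpM2r ?exprn_ge0//.
  apply: (@le_trans _ _ (6 * (81 / 16) * 9^-1)); last by lra.
  by rewrite ler_pM ?mulr_ge0 ?expR_ge0 ?invr_ge0 ?exprn_ge0 ?pi_ge0// ler_wpM2l.
rewrite ler_pdivrMr// [leRHS]mulrAC ler_pdivlMr//.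
by move: num; move: (l%:R ^+ (2 * l)) (l.+1%:R ^+ 2) => a b; lra.
Qed.

(** * Choice of the parameters *)

Lemma bernoulli_le (R : realType) (t : R) (n : nat) : 0 <= t <= 1 ->
  1 - n%:R * t <= (1 - t) ^+ n.
Proof.
move=> /andP[t0 t1]; elim: n => [|n IH]; first by rewrite mul0r subr0 expr0.
have t1' : 0 <= 1 - t by rewrite subr_ge0.
rewrite exprS; apply: le_trans (ler_wpM2l t1' IH).
have : 0 <= n%:R * (t * t) by rewrite mulr_ge0// mulr_ge0.
rewrite -natr1; lra.
Qed.

(** With x = log y / (l+1), the bounds on S and S_d give
log^(2l)(y) ((x - 1)^2 - (x + 1)^2 / 2), and the bracket equals
x^2 / 2 - 3 x + 1/2, which exceeds theta x^2 / 2 once (1 - theta) x >= 6. *)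
Lemma coprime_sum_asymptotic (R : realType) (l : nat) (theta : R) : theta < 1 ->
  exists2 L0 : R, 0 <= L0 & forall y, (0 < y)%N -> L0 <= ln y%:R ->
    theta * (2^-1 * (l.+1%:R ^+ 2)^-1) * ln y%:R ^+ (2 + 2 * l)
      <= coprime_sum R l y.
Proof.
move=> t1; pose d := 1 - theta; have d0 : 0 < d by rewrite subr_gt0.
have w0 : 0 < (l.+1%:R : R) by [].
exists ((6 / d + 1) * l.+1%:R).
  by rewrite mulr_ge0// addr_ge0// divr_ge0// ltW.
move=> y y0; rewrite -ler_pdivlMr// => hL.
apply: le_trans (coprime_sum_ge R l y0).
have := sum_log_weight_ge R l y0; set S := \sum_(_ <= _ < _) _.
set L := ln (y%:R : R) in hL *; set P := L ^+ l.
have -> : L ^+ (2 + 2 * l) = L ^+ 2 * P ^+ 2 by rewrite exprD mulnC exprM.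
have -> : L ^+ l.+1 / l.+1%:R = (L / l.+1%:R) * P by rewrite exprS mulrAC.
have -> : theta * (2^-1 * (l.+1%:R ^+ 2)^-1) * (L ^+ 2 * P ^+ 2)
    = (theta * 2^-1 * (L / l.+1%:R) ^+ 2) * P ^+ 2.
  by rewrite exprMn exprVn; move: ((l.+1%:R ^+ 2)^-1) => v; lra.
have P0 : 0 <= P by rewrite exprn_ge0// ln_nat_ge0.
move: (L / l.+1%:R) hL => x hx hS.
have x1 : 0 <= x - 1.
  by rewrite subr_ge0; apply: le_trans hx; rewrite lerDr divr_ge0// ltW.
have dx : 6 <= d * x.
  by rewrite mulrC -ler_pdivrMr//; apply: le_trans hx; rewrite lerDl.
have S2 : ((x - 1) * P) ^+ 2 <= S ^+ 2.
  have le : (x - 1) * P <= S by rewrite mulrBl mul1r.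
  have xP : 0 <= (x - 1) * P by rewrite mulr_ge0.
  by rewrite lerXn2r// nnegrE// (le_trans xP).
have x0 : 0 <= x by lra.
have dx0 : 0 <= (d * x - 6) * x by rewrite mulr_ge0// subr_ge0.
have P2 : 0 <= P ^+ 2 by rewrite exprn_ge0.
have := mulr_ge0 dx0 P2.
by move: S2 P2; rewrite /d; lra.
Qed.

(** The ratio of the sizes is (1 - y / (y^3 + y))^r with r <= y. *)
Lemma card_prime_box_ratio (R : realType) (y : nat) : (0 < y)%N ->
  (1 - y%:R^-1) * #|` prime_box y (y ^ 3 + y)|%:R
    <= #|` prime_box y (y ^ 3)|%:R :> R.
Proof.
move=> y0; have yp : 0 < (y%:R : R) by rewrite ltr0n.
rewrite !card_prime_box; set r := #|_|; have ry : (r <= y)%N := card_small_prime y.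
have F0 : 0 < ((y ^ 3 + y)%:R : R) by rewrite ltr0n addn_gt0 y0 orbT.
pose t : R := y%:R / (y ^ 3 + y)%:R.
have ty : y%:R * t <= y%:R^-1.
  rewrite /t mulrA ler_pdivrMr// [leRHS]mulrC ler_pdivlMr//.
  by rewrite -!natrM ler_nat !expnS expn0 muln1 mulnA leq_addr.
have t0 : 0 <= t by rewrite divr_ge0.
have t1 : t <= 1 by rewrite /t ler_pdivrMr// mul1r ler_nat leq_addl.
have -> : ((y ^ 3) ^ r)%:R = (1 - t) ^+ r * ((y ^ 3 + y) ^ r)%:R :> R.
  rewrite !natrX -exprMn; congr (_ ^+ _).
  by rewrite mulrBl /t divfK ?gt_eqF// mul1r natrD addrK natrX.
rewrite ler_wpM2r//; apply: le_trans (bernoulli_le r _); last by rewrite t0.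
rewrite lerD2l lerN2; apply: le_trans ty.
by rewrite ler_wpM2r// ler_nat.
Qed.

Lemma card_prime_box_le (R : realType) (y : nat) : (1 < y)%N ->
  #|` prime_box y (y ^ 3 + y)|%:R <= expR (4 * (y%:R * ln y%:R)) :> R.
Proof.
move=> y1; have yp : 0 < (y%:R : R) by rewrite ltr0n ltnW.
have -> : expR (4 * (y%:R * ln y%:R)) = ((y ^ 4) ^ y)%:R :> R.
  by rewrite mulrCA expRM_natl expRM_natl lnK// !natrX.
rewrite ler_nat card_prime_box.
have y3 : (y ^ 3 + y <= y ^ 4)%N by rewrite !expnS expn0; nia.
apply: (@leq_trans ((y ^ 4) ^ #|small_prime y|)).
  by case: #|_| => // r; rewrite leq_exp2r.
apply: leq_pexp2l (card_small_prime y).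
by rewrite expn_gt0 ltnW.
Qed.

(** Z stands for log log N.  The choice is y about e^(theta Z): then
4 y log y is O(Z e^(theta Z)), negligible against log N = e^Z, so the box has
at most (1 - theta) N elements. *)
Lemma box_parameter (R : realType) (theta L0 : R) : 0 < theta < 1 -> 0 <= L0 ->
  exists Z0 : R, forall Z, Z0 <= Z -> exists y : nat,
    [/\ (1 < y)%N, theta * Z <= ln y%:R, L0 <= ln (y%:R : R),
        theta <= 1 - y%:R^-1 &
        expR (4 * (y%:R * ln y%:R)) <= (1 - theta) * expR (expR Z)].
Proof.
move=> /andP[t0 t1] L00; pose d := 1 - theta; have d0 : 0 < d by rewrite subr_gt0.
have d1 : d <= 1 by rewrite /d; lra.
pose a := 36 / d ^+ 2; pose b := L0 / theta; pose e := (theta * d)^-1.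
have [a0 b0] : 0 < a /\ 0 <= b.
  by rewrite divr_gt0 ?exprn_gt0// divr_ge0// ltW.
have e0 : 0 < e by rewrite invr_gt0 mulr_gt0.
exists (a + b + e) => Z hZ; rewrite -/d.
have hZ1 : 36 <= d ^+ 2 * Z.
  by rewrite mulrC -ler_pdivrMr ?exprn_gt0// -/a; lra.
have hZ2 : L0 <= theta * Z by rewrite mulrC -ler_pdivrMr// -/b; lra.
have hZ3 : 1 <= theta * Z * d.
  rewrite mulrAC mulrC -ler_pdivrMr ?mulr_gt0// mul1r -/e; lra.
have Zp : 0 < Z by lra.
clear a b e a0 b0 e0 hZ.
have dZ0 : 0 <= d * Z by rewrite mulr_ge0// ltW.
have tZ0 : 0 < theta * Z by rewrite mulr_gt0.
pose T := expR (theta * Z); have T0 : 0 <= T := expR_ge0 _.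
have T1 : 1 + theta * Z <= T by exact: expR_ge1Dx.
pose y := (Num.truncn T).+1; exists y.
have Ty : T <= y%:R by apply: ltW; exact: truncnS_gt.
have y2T : y%:R <= 2 * T.
  have : (Num.truncn T)%:R <= T by rewrite truncn_le.
  by rewrite /y -natr1; lra.
have y1 : (1 < y)%N by rewrite -(ltr_nat R); lra.
have eZ : expR Z = T * expR (d * Z) by rewrite /T -expRD; congr expR; rewrite /d; lra.
have edZ : 9 * Z <= expR (d * Z).
  have := expR_ge_pow (isT : (0 < 2)%N) dZ0.
  have : 36 * Z <= d ^+ 2 * Z * Z by rewrite ler_wpM2r// ltW.
  by rewrite exprMn expr2; lra.
have Z36 : 36 <= Z.
  by apply: le_trans hZ1 _; rewrite ler_piMl ?(ltW Zp)// expr_le1 ?(ltW d0).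
have lnyZ : ln y%:R <= Z.
  rewrite -ler_expR lnK ?posrE ?ltr0n// eZ; apply: le_trans y2T _.
  by rewrite mulrC ler_wpM2l//; lra.
have lny : theta * Z <= ln y%:R by rewrite -ler_expR lnK// posrE ltr0n.
split=> //; first exact: le_trans lny.
  have h : y%:R^-1 <= d.
    rewrite -(ler_pM2r (_ : 0 < y%:R))// mulVf ?pnatr_eq0//.
    rewrite mulrC; apply: le_trans hZ3 _; rewrite ler_wpM2r ?(ltW d0)//.
    by apply: le_trans Ty; lra.
  by move: h; rewrite /d; lra.
have yl : 4 * (y%:R * ln y%:R) <= 8 * (T * Z).
  have : y%:R * ln y%:R <= 2 * T * Z by rewrite ler_pM// ln_nat_ge0.
  by lra.
have dexp : 1 <= d * expR Z.
  have h : d * (1 + Z) <= d * expR Z by rewrite ler_wpM2l ?(ltW d0)// expR_ge1Dx.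
  apply: le_trans h; have : d * (d * Z) <= d * Z by rewrite ler_piMl.
  by move: hZ1; rewrite expr2 -mulrA; lra.
apply: (@le_trans _ _ (d * (expR Z * expR (8 * (T * Z))))).
  by rewrite [leRHS]mulrA -[leLHS]mul1r ler_pM ?expR_ge0// ler_expR.
rewrite ler_wpM2l ?(ltW d0)// -expRD ler_expR eZ.
have h9 : T * (9 * Z) <= T * expR (d * Z) by rewrite ler_wpM2l.
have hT : Z <= T * Z by rewrite ler_peMl ?(ltW Zp)//; lra.
by move: h9 hT; rewrite -eZ; lra.
Qed.

(** One factor theta comes from the rounding of N to a multiple of the size of
the box, one from the ratio of sizes of the two boxes, one from the bound on
the coprime sum. *)
Lemma exists_gcd_sum_ge (R : realType) (l : nat) (theta : R) : 0 < theta < 1 ->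
  \forall N \near \oo, exists M : {fset nat}, [/\ positive_fset M, #|` M| = N &
    theta ^+ 3 * (2^-1 * (l.+1%:R ^+ 2)^-1) * N%:R
      * (theta * ln (ln N%:R)) ^+ (2 + 2 * l) <= gcd_sum R l M].
Proof.
move=> t01; have [t0 t1] := andP t01; set K : R := 2^-1 * _.
have K0 : 0 < K by rewrite mulr_gt0// invr_gt0 exprn_gt0.
have [L0 L00 hC] := coprime_sum_asymptotic l t1.
have [Z0 hZ0] := box_parameter t01 L00.
near=> N.
have NZ : expR (expR (Num.max Z0 0)) <= N%:R by near: N; exact: nbhs_infty_ger.
have N0 : 0 < (N%:R : R) by apply: lt_le_trans NZ; exact: expR_gt0.
have lnN : expR (Num.max Z0 0) <= ln N%:R by rewrite -ler_expR lnK.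
have lnN0 : 0 < ln (N%:R : R) by apply: lt_le_trans lnN; exact: expR_gt0.
set Z := ln (ln N%:R).
have : Num.max Z0 0 <= Z by rewrite -ler_expR lnK.
rewrite ge_max => /andP[/hZ0[y [y1 lny yL0 yt yN]] Z_ge0].
have y0 : (0 < y)%N := ltnW y1.
have NE : expR (expR Z) = N%:R by rewrite !lnK.
pose B := prime_box y (y ^ 3 + y); pose A := prime_box y (y ^ 3).
set D := #|` B|.
have D0 : (0 < D)%N by rewrite /D card_prime_box expn_gt0 addn_gt0 y0 orbT.
have DN : D%:R <= (1 - theta) * N%:R.
  by rewrite -NE; apply: le_trans (card_prime_box_le R y1) yN.
have [M [M0 cM sM]] := exists_gcd_sum_copies R l
  (@prime_box_gt0 y (y ^ 3 + y)) (leq_divM N D).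
exists M; split=> //; apply: le_trans sM; rewrite -/B.
have kD : theta * N%:R <= (N %/ D)%:R * D%:R.
  have : (N%:R : R) <= (N %/ D)%:R * D%:R + D%:R.
    by rewrite -natrM -natrD ler_nat {1}(divn_eq N D) leq_add2l ltnW// ltn_mod.
  by move: DN; lra.
have cA : theta * D%:R <= #|` A|%:R.
  by apply: le_trans (card_prime_box_ratio R y0); rewrite ler_wpM2r.
have sB : #|` A|%:R * coprime_sum R l y <= gcd_sum R l B.
  apply: gcd_sum_ge_coprime_sum; first exact: prime_box_gt0.
  by move=> m a mA ay; apply: mul_prime_box.
set q := (2 + 2 * l)%N; have tZ0 : 0 <= theta * Z by rewrite mulr_ge0// ltW.
pose c := theta * K * (theta * Z) ^+ q.
have c0 : 0 <= c by rewrite mulr_ge0 ?exprn_ge0// mulr_ge0// ltW.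
have cC : c <= coprime_sum R l y.
  apply: le_trans (hC y y0 yL0); rewrite ler_wpM2l//; first by rewrite mulr_ge0// ltW.
  by rewrite lerXn2r ?nnegrE ?ln_nat_ge0.
apply: (@le_trans _ _ ((N %/ D)%:R * (theta * D%:R * c))).
  have -> : theta ^+ 3 * K * N%:R * (theta * Z) ^+ q = theta * N%:R * (theta * c).
    by rewrite /c; lra.
  have -> : (N %/ D)%:R * (theta * D%:R * c) = (N %/ D)%:R * D%:R * (theta * c) by lra.
  by rewrite ler_wpM2r// mulr_ge0// ltW.
rewrite ler_wpM2l//; apply: le_trans sB.
by rewrite ler_pM// mulr_ge0// ltW.
Unshelve. all: by end_near. Qed.

Theorem proposition2 (R : realType) (l : nat) (c : R)
  (l_gt0 : (0 < l)%N) (c_gt0 : 0 < c)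
  (c_lt : c < 6 * expR (2 * euler_gamma R) * (pi ^+ 2)^-1
              * l%:R ^+ (2 * l) * ((2 * l + 1)%:R ^+ (2 * l + 1))^-1) :
  \forall N \near \oo, exists v : R,
    is_max [set log_gcd_sum R l M | M in pos_fsets_of_size N] v /\
    c * N%:R * ln (ln N%:R) ^+ (2 + 2 * l) <= v.
Proof.
set q := (2 + 2 * l)%N; pose K : R := 2^-1 * (l.+1%:R ^+ 2)^-1.
have cK : c < K := lt_le_trans c_lt (gamma_constant_le R l_gt0).
have K0 : 0 < K by apply: lt_trans cK.
(* By Bernoulli's inequality, this makes (1 - e)^(3 + q) at least c / K. *)
pose e := (1 - c / K) / (3 + q)%:R.
have q0 : 0 < ((3 + q)%:R : R) by [].
have e0 : 0 < e by rewrite divr_gt0// subr_gt0 ltr_pdivrMr// mul1r.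
have e1 : e < 1.
  rewrite ltr_pdivrMr// mul1r.
  apply: (@lt_le_trans _ _ 1); last by rewrite ler1n.
  by rewrite ltrBlDr ltrDl divr_gt0.
have theta01 : 0 < 1 - e < 1 by apply/andP; split; lra.
have cE : c <= (1 - e) ^+ (3 + q) * K.
  rewrite -ler_pdivrMr//; apply: le_trans (bernoulli_le _ _); last by rewrite !ltW.
  by rewrite /e [_%:R * _]mulrC divfK ?gt_eqF//; lra.
near=> N.
have [M [M0 cM sM]] : exists M : {fset nat}, [/\ positive_fset M, #|` M| = N &
    (1 - e) ^+ 3 * K * N%:R * ((1 - e) * ln (ln N%:R)) ^+ q <= gcd_sum R l M].
  by near: N; exact: exists_gcd_sum_ge.
have NZ : expR 1 <= N%:R :> R by near: N; exact: nbhs_infty_ger.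
have lnN : 1 <= ln (N%:R : R).
  by rewrite -ler_expR lnK// posrE (lt_le_trans (expR_gt0 1)).
have [X [X0 cX Xmax]] := exists_max_gcd_sum R N l_gt0.
have sumE Y : positive_fset Y -> log_gcd_sum R l Y = gcd_sum R l Y.
  exact: log_gcd_sumE.
exists (gcd_sum R l X); split.
  split; first by exists X => //; exact: sumE.
  by move=> _ [Y [Y0 cY] <-]; rewrite sumE//; exact: Xmax.
apply: le_trans (Xmax M M0 cM); apply: le_trans sM.
rewrite exprMn [leRHS](_ : _ = (1 - e) ^+ (3 + q) * K * N%:R * ln (ln N%:R) ^+ q).
  by rewrite ler_wpM2r ?exprn_ge0 ?ln_ge0// ler_wpM2r.
by rewrite exprD; move: ((1 - e) ^+ 3) ((1 - e) ^+ q) => a b; lra.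
Unshelve. all: by end_near. Qed.
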